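(* Let $\beta\in(0,1]$. Let $u_0(x,t)=\left(\frac32\right)^{1/2}\cos\left(\frac x3\right)$ and let $u_{n+1}$, $n\ge0$, be determined recursively by $$\partial_t^\beta u_{n+1}=-\partial_xw_n-\partial_x^3w_n,\qquad u_{n+1}(x,0)=0,\qquad w_n=\sum_{n_1+n_2+n_3=n}u_{n_1}u_{n_2}u_{n_3}$$ (sum over ordered triples of nonnegative integers). Then there exists a real sequence $\{c_n(\beta)\}_{n=0}^\infty$ with $$c_n=1\ \text{ for } n=0,1,2,\qquad c_3=\frac{3\Gamma(1+\beta)^2-\Gamma(1+2\beta)}{\Gamma(1+\beta)^2},$$ such that for all $n\ge0$, $$u_n(x,t)=(-1)^{\lfloor n/2\rfloor}\frac{c_n(\beta)\,2^{-\frac12}\,3^{-(n-\frac12)}\,t^{\beta n}}{\Gamma(1+\beta n)}\,\psi_n\!\left(\frac x3\right),\qquad\psi_n=\begin{cases}\cos,&n\text{ even},\\ \sin,&n\text{ odd},\end{cases}$$ and $$c_{n+1}=(-1)^{\lfloor n/2\rfloor}\sum_{n_1+n_2+n_3=n}\frac{(-1)^{\lfloor n_1/2\rfloor+\lfloor n_2/2\rfloor+\lfloor n_3/2\rfloor}\,3^{-\sigma(n_1,n_2,n_3)}\,\Gamma(1+\beta n)\,c_{n_1}c_{n_2}c_{n_3}}{\Gamma(1+\beta n_1)\Gamma(1+\beta n_2)\Gamma(1+\beta n_3)},$$ where $\sigma(n_1,n_2,n_3)=0$ if $n_1,n_2,n_3$ are all even or all odd, and $\sigma(n_1,n_2,n_3)=1$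 otherwise. Therefore $u(x,t)=\sum_{n=0}^\infty u_n(x,t)$ satisfies $$u(x,t)=\left(\sum_{k=0}^\infty(-1)^k\frac{c_{2k}(\beta)2^{-\frac12}3^{-(2k-\frac12)}t^{2\beta k}}{\Gamma(1+2\beta k)}\right)\cos\left(\frac x3\right)+\left(\sum_{k=0}^\infty(-1)^k\frac{c_{2k+1}(\beta)2^{-\frac12}3^{-(2k+\frac12)}t^{\beta(2k+1)}}{\Gamma(1+\beta(2k+1))}\right)\sin\left(\frac x3\right)$$ for all $x\in\mathbb{R}$ and all $t\ge0$ at which the two series in parentheses converge.
   Context: For $\beta\in(0,1)$, $\partial_t^\beta$ is the Caputo derivative $\partial_t^\beta f(t)=\frac{1}{\Gamma(1-\beta)}\int_0^tf'(\tau)(t-\tau)^{-\beta}d\tau$; for $\beta=1$ it is the ordinary derivative. The problem $\partial_t^\beta v=F(t)$, $v(0)=v_0$, is solved by $v(t)=v_0+\frac{1}{\Gamma(\beta)}\int_0^tF(\tau)(t-\tau)^{\beta-1}d\tau$; the recursion for $u_{n+1}$ is understood in this sense. The $u_n$ are the terms produced by the homotopy perturbation method applied to the fractional $K(3,3)$ equation $\partial_t^\beta u+\partial_x(u^3)+\partial_x^3(u^3)=0$ with initial datum $u_0$. *)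

(* Defs.v *)
From HB Require Import structures.
From mathcomp Require Export all_boot all_order all_algebra.
From mathcomp Require Export all_classical all_reals all_analysis.

Set Implicit Arguments.
Unset Strict Implicit.
Unset Printing Implicit Defensive.

Export Order.TTheory GRing.Theory Num.Theory.
Export numFieldNormedType.Exports.

#[global] Open Scope classical_set_scope.
#[global] Open Scope ring_scope.

Definition Gamma {R : realType} (a : R) : R :=
  \int[lebesgue_measure]_(s in `]0, +oo[) (s `^ (a - 1) * expR (- s)).

(* [v] solves the Caputo problem D_t^beta v = F, v(0) = v0 on [0, +oo[, in the
   integrated (Volterra) sense.  For beta = 1 this is
   v(t) = v0 + \int_0^t F.  The value of the kernel at s = t is immaterial. *)
Definition caputo_solution {R : realType} (beta : R) (F : R -> R) (v0 : R)
    (v : R -> R) : Prop :=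
  forall t : R, 0 <= t ->
    v t = v0 + (Gamma beta)^-1 *
      \int[lebesgue_measure]_(s in `[0, t]) (F s * (t - s) `^ (beta - 1)).

Definition sum_triples {R : realType} (n : nat) (f : nat -> nat -> nat -> R)
    : R :=
  \sum_(n1 < n.+1) \sum_(n2 < n.+1)
    \sum_(n3 < n.+1 | (n1 + n2 + n3 == n)%N) f n1 n2 n3.

(* Functions of two variables take the space variable x first, then t. *)
Definition hpm_cubic {R : realType} (u : nat -> R -> R -> R) (n : nat)
    (x t : R) : R :=
  sum_triples n (fun n1 n2 n3 => u n1 x t * u n2 x t * u n3 x t).

Definition hpm_source {R : realType} (u : nat -> R -> R -> R) (n : nat)
    (x t : R) : R :=
  - ((fun y => hpm_cubic u n y t)^`())%classic x
  - ((fun y => hpm_cubic u n y t)^`(3))%classic x.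

Definition psi {R : realType} (n : nat) : R -> R := if odd n then sin else cos.

Definition sigma (n1 n2 n3 : nat) : nat :=
  if (odd n1 == odd n2) && (odd n2 == odd n3) then 0%N else 1%N.

(* Main.v *)
From mathcomp Require Import zify ring lra.
Require Import Defs.
From mathcomp Require Import measurable_realfun.

(**
Products of three functions among cos and sin linearize into a first and a third
harmonic: psi_i psi_j psi_k (z) = (3/4) 3^(-sigma) psi_n(z) + q psi_n(3 z) with
n = i + j + k. At z = x/3 the third harmonic has frequency 1 and is killed by
d_x + d_x^3, while the first one is multiplied by +-(1/3 - 1/27). Hence each
u_n stays a monomial a_n t^(beta n) psi_n(x/3), and the Volterra equation becomes
the recursion for a_n as soon as one knows the Riemann-Liouville integral of a
power, i.e. Gamma(a) Gamma(b) = Gamma(a + b) Beta(a, b) for real a, b > 0. That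
identity follows from Tonelli's theorem together with the invariance of the
Lebesgue measure under translations and its homogeneity under dilations.
*)

(** * Affine changes of variables *)

(** The push-forward of Lebesgue measure under x -> c x + d, multiplied by c, gives every half-open
    interval its length. By uniqueness it is Lebesgue measure, and the formula is the change of
    variables for a push-forward. *)
Lemma ge0_integral_affine {R : realType} (c d : R) (f : R -> \bar R) :
  0 < c -> measurable_fun setT f -> (forall x, (0 <= f x)%E) ->
  (\int[@lebesgue_measure R]_x f (c * x + d)%R =
   c^-1%:E * \int[@lebesgue_measure R]_x f x)%E.
Proof.
move=> c0 mf f0.
pose phi : measurableTypeR R -> measurableTypeR R := fun x : R => c * x + d.
have mphi : measurable_fun setT phi.
  by apply: measurable_funD => //; apply: measurable_funM.
have cp := ltW c0.
pose m1 : {measure set (measurableTypeR R) -> \bar R} :=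
  measure_function_pushforward__canonical__measure_function_Measure
    (@lebesgue_measure R) mphi.
pose m' : {measure set (measurableTypeR R) -> \bar R} := mscale (NngNum cp) m1.
have H A : measurable A -> lebesgue_measure A = m' A.
  apply: lebesgue_measure_unique => X [[a b] _ <-] /=.
  rewrite /mscale /= /pushforward.
  have -> : phi @^-1` `]a, b] = `]((a - d) / c), ((b - d) / c)]%classic.
    apply/seteqP; split => x /=; rewrite !in_itv/= /phi.
      by rewrite ltr_pdivrMr// ler_pdivlMr// ltrBlDr lerBrDr mulrC.
    by rewrite ltr_pdivrMr// ler_pdivlMr// ltrBlDr lerBrDr mulrC.
  rewrite !lebesgue_measure_itv /= !lte_fin ltr_pM2r ?invr_gt0// ltrD2r.
  case: ifP => _; last by rewrite mule0.
  rewrite -!EFinB -EFinM; congr EFin; field; exact: lt0r_neq0.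
have -> : (\int[lebesgue_measure]_x f x = \int[m']_x f x)%E.
  by apply: eq_measure_integral => A mA _; exact: H.
rewrite /m' ge0_integral_mscale//= muleA -EFinM mulVf ?lt0r_neq0// mul1e.
by rewrite (ge0_integral_pushforward mphi).
Qed.

(** * Gamma and Beta integrals *)

Lemma ge0_integral_shift {R : realType} (d : R) (f : R -> \bar R) :
  measurable_fun setT f -> (forall x, (0 <= f x)%E) ->
  (\int[@lebesgue_measure R]_x f (x + d)%R = \int[@lebesgue_measure R]_x f x)%E.
Proof.
move=> mf f0; have := ge0_integral_affine 1 d f ltr01 mf f0.
by rewrite invr1 mul1e => <-; apply: eq_integral => x _; rewrite mul1r.
Qed.

(* The truncated power [x_+^p]: it lets every integral below range over [R]. *)
Definition tpow {R : realType} (p x : R) : R := if 0 < x then x `^ p else 0.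

Lemma tpow_ge0 {R : realType} (p x : R) : 0 <= tpow p x.
Proof. by rewrite /tpow; case: ifP => // _; exact: powR_ge0. Qed.

Lemma measurable_tpow {R : realType} (p : R) : measurable_fun setT (tpow p).
Proof.
by apply: measurable_fun_ifT => //; exact: measurable_fun_ltr.
Qed.

(** Kept in the extended reals so that Tonelli's theorem applies before finiteness is known. *)
Definition egamma {R : realType} (a : R) : \bar R :=
  (\int[@lebesgue_measure R]_x (tpow (a - 1) x * expR (- x))%:E)%E.

(* The convolution of [x_+^(a-1)] and [x_+^(b-1)] at [t]; Beta(a, b) is [t = 1]. *)
Definition ebeta {R : realType} (a b t : R) : \bar R :=
  (\int[@lebesgue_measure R]_x (tpow (a - 1) x * tpow (b - 1) (t - x))%:E)%E.

Lemma tpowZ {R : realType} (p t x : R) : 0 < t ->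
  tpow p (t * x) = t `^ p * tpow p x.
Proof.
move=> t0; rewrite /tpow pmulr_rgt0//; case: ifPn => [x0|_]; last by rewrite mulr0.
by rewrite powRM// ltW.
Qed.

Lemma ebeta_ge0 {R : realType} (a b t : R) : (0 <= ebeta a b t)%E.
Proof. by apply: integral_ge0 => x _; rewrite lee_fin mulr_ge0 ?tpow_ge0. Qed.

Lemma egamma_ge0 {R : realType} (a : R) : (0 <= egamma a)%E.
Proof. by apply: integral_ge0 => x _; rewrite lee_fin mulr_ge0 ?tpow_ge0 ?expR_ge0. Qed.

Lemma GammaE {R : realType} (a : R) : Gamma a = fine (egamma a).
Proof.
rewrite /Gamma /Rintegral integral_mkcond /egamma; congr fine.
apply: eq_integral => x _; rewrite /patch /tpow mem_setE/= in_itv/= andbT.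
by case: ifP => //; rewrite mul0r.
Qed.

Lemma measurable_beta_integrand {R : realType} (a b t : R) :
  measurable_fun setT (fun x : R => (tpow a x * tpow b (t - x))%:E).
Proof.
apply/measurable_EFinP.
apply: measurable_funM; first exact: measurable_tpow.
apply: measurableT_comp; first exact: measurable_tpow.
exact: measurable_funB.
Qed.

Lemma ge0_integralZl_real {R : realType} (k : R) (f : R -> R) :
  0 <= k -> (forall x, 0 <= f x) -> measurable_fun setT (EFin \o f) ->
  (\int[@lebesgue_measure R]_x (k * f x)%:E =
   k%:E * \int[@lebesgue_measure R]_x (f x)%:E)%E.
Proof.
move=> k0 f0 mf; under eq_integral => x _ do rewrite EFinM.
by apply: ge0_integralZl_EFin => // x _; rewrite lee_fin.
Qed.

Lemma ge0_integralZr_real {R : realType} (k : \bar R) (f : R -> R) :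
  (0 <= k)%E -> (forall x, 0 <= f x) -> measurable_fun setT (EFin \o f) ->
  (\int[@lebesgue_measure R]_x ((f x)%:E * k) =
   \int[@lebesgue_measure R]_x (f x)%:E * k)%E.
Proof.
by move=> k0 f0 mf; apply: ge0_integralZr => // x _; rewrite lee_fin.
Qed.

(** Substitute x -> t x for t > 0. For t <= 0 both sides vanish, since x > 0 and t - x > 0 are
    incompatible. *)
Lemma ebetaE {R : realType} (a b t : R) :
  ebeta a b t = ((tpow (a + b - 1) t)%:E * ebeta a b 1)%E.
Proof.
have [t0|t0] := ltP 0 t; last first.
  rewrite {1}/tpow ltNge t0/= mul0e /ebeta integral0_eq// => x _.
  rewrite /tpow; case: ifPn; rewrite ?mul0r// => x0.
  by case: ifPn; rewrite ?mulr0// => x1; exfalso; lra.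
have E := @ge0_integral_affine R t 0
  (fun x => (tpow (a - 1) x * tpow (b - 1) (t - x))%:E) t0
  (measurable_beta_integrand (a - 1) (b - 1) t)
  (fun x => mulr_ge0 (tpow_ge0 (a - 1) x) (tpow_ge0 (b - 1) (t - x))).
rewrite -/(ebeta a b t) in E.
have -> : ebeta a b t = (t%:E * (t^-1%:E * ebeta a b t))%E.
  by rewrite muleA -EFinM divff ?mul1e// gt_eqF.
rewrite -E.
under eq_integral => x _.
  have -> : t - (t * x + 0) = t * (1 - x) by ring.
  rewrite addr0 !tpowZ// mulrACA.
  over.
rewrite ge0_integralZl_real; first last.
- exact: measurable_beta_integrand.
- by move=> x; rewrite mulr_ge0 ?tpow_ge0.
- by rewrite mulr_ge0 ?powR_ge0.
rewrite muleA -EFinM -/(ebeta a b 1); congr (_%:E * _)%E.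
(* The Jacobian t is read as t^1, so the exponents add up to 1 + (a - 1) + (b - 1) = a + b - 1. *)
rewrite /tpow t0 -[X in X * _](powRr1 (ltW t0)) -!powRD; last 2 first.
- by rewrite (gt_eqF t0) implybT.
- by rewrite (gt_eqF t0) implybT.
by congr powR; ring.
Qed.

Lemma measurable_egamma_integrand {R : realType} (p : R) :
  measurable_fun setT (fun x : R => (tpow p x * expR (- x))%:E).
Proof.
apply/measurable_EFinP/measurable_funM; first exact: measurable_tpow.
exact: measurableT_comp.
Qed.

(** Translating the inner variable by x turns the product into the double integral of x_+^(a-1)
    (y-x)_+^(b-1) e^(-y). After exchanging the integrals, the one in x is [ebeta a b y], which
    scales as y_+^(a+b-1). *)
Lemma egammaM {R : realType} (a b : R) :
  (egamma a * egamma b = egamma (a + b) * ebeta a b 1)%E.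
Proof.
have mg (p : R) := measurable_egamma_integrand p.
have g0 (p x : R) : 0 <= tpow p x * expR (- x).
  by rewrite mulr_ge0 ?tpow_ge0 ?expR_ge0.
rewrite {1}/egamma -ge0_integralZr_real;
  [|exact: egamma_ge0|exact: g0|exact: mg].
pose h (z : R * R) : \bar R :=
  (tpow (a - 1) z.1 * tpow (b - 1) (z.2 - z.1) * expR (- z.2))%:E.
transitivity (\int[@lebesgue_measure R]_x \int[@lebesgue_measure R]_y h (x, y))%E.
  apply: eq_integral => x _.
  rewrite /egamma -(@ge0_integral_shift R (- x)
    (fun y => (tpow (b - 1) y * expR (- y))%:E) (mg _) (g0 _)).
  rewrite -ge0_integralZl_real //; last first.
    apply: (measurableT_comp (mg (b - 1))) => //.
    exact: measurable_funD.
  apply: eq_integral => y _; rewrite /h/=; congr EFin.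
  by rewrite mulrACA -!mulrA -expRD; congr (_ * (_ * expR _)); ring.
rewrite fubini_tonelli/=; last 2 first.
- apply/measurable_EFinP/measurable_funM => //=.
  + apply: measurable_funM.
      by apply: measurableT_comp; [exact: measurable_tpow|exact: measurable_fst].
    apply: measurableT_comp; first exact: measurable_tpow.
    by apply: measurable_funB; [exact: measurable_snd|exact: measurable_fst].
  + apply: measurableT_comp; first exact: measurable_expR.
    by apply: measurableT_comp; [exact: oppr_measurable|exact: measurable_snd].
- by move=> z; rewrite lee_fin !mulr_ge0 ?tpow_ge0 ?expR_ge0.
rewrite /egamma -ge0_integralZr_real;
  [|exact: ebeta_ge0|exact: g0|exact: mg].
apply: eq_integral => y _; rewrite /h/=.
under eq_integral => x _ do rewrite mulrC.
rewrite ge0_integralZl_real; first last.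
- exact: measurable_beta_integrand.
- by move=> x; rewrite mulr_ge0 ?tpow_ge0.
- exact: expR_ge0.
by rewrite -/(ebeta a b y) ebetaE muleA -EFinM mulrC.
Qed.

(** * Finiteness and positivity of Gamma *)

(** The integrand may blow up at 0, so ]0, 1] is exhausted by compact intervals [e, 1], on which the
    fundamental theorem of calculus gives 1 - e^a <= 1; monotone convergence concludes. *)
Lemma integral_powR_01_le1 {R : realType} (a : R) : 0 < a ->
  (\int[@lebesgue_measure R]_(x in `]0%R, 1%R]) (a * x `^ (a - 1))%:E <= 1)%E.
Proof.
move=> a0.
pose f (x : R) := a * x `^ (a - 1).
(* With n + 2 instead of n + 1 the left endpoint stays strictly below 1 even for n = 0. *)
pose F (n : nat) : set R := `[n.+2%:R^-1, 1]%classic.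
have f0 x : 0 <= f x by rewrite mulr_ge0 ?powR_ge0// ltW.
have mf : measurable_fun setT f.
  by apply: measurable_funM => //; exact: measurable_powR.
have FE : `]0%R, 1%R]%classic = \bigcup_n F n.
  apply/seteqP; split => x /=.
    rewrite in_itv/= => /andP[x0 x1].
    exists (Num.truncn x^-1) => //=; rewrite /F/= in_itv/= x1 andbT.
    rewrite invf_ple ?posrE//.
    apply: le_trans (ltW (truncnS_gt _)) _.
    by rewrite ler_nat.
  move=> [n _]; rewrite /F/= !in_itv/= => /andP[nx ->]; rewrite andbT.
  by apply: lt_le_trans nx; rewrite invr_gt0.
have cv : (\int[@lebesgue_measure R]_(x in F n) (f x)%:E)%E @[n --> \oo] -->
          (\int[@lebesgue_measure R]_(x in `]0%R, 1%R]) (f x)%:E)%E.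
  rewrite FE; apply: ge0_nondecreasing_set_cvg_integral.
  - move=> n m nm; apply/subsetPset => x; rewrite /F/= !in_itv/= => /andP[nx ->].
    rewrite andbT; apply: le_trans nx.
    by rewrite lef_pV2 ?posrE// ler_nat.
  - by move=> i; exact: measurable_itv.
  - by move=> i; apply/measurable_EFinP; apply: measurable_funTS.
  - by move=> i x _; rewrite lee_fin.
rewrite -(cvg_lim _ cv)//; apply: lime_le; first by apply/cvg_ex; eexists; exact: cv.
apply: nearW => n.
have n0 : 0 < n.+2%:R^-1 :> R by rewrite invr_gt0.
have n1 : n.+2%:R^-1 < 1 :> R by rewrite invf_lt1 ?ltr1n.
have cont (p x : R) : 0 < x -> {for x, continuous (fun y : R => y `^ p)}.
  move=> x0; apply: differentiable_continuous; apply/derivable1_diffP.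
  by apply: derivable_powR; rewrite in_itv/= x0.
rewrite (@continuous_FTC2 R f (fun y : R => y `^ a))//.
- by rewrite powR1 -EFinB lee_fin lerBlDr lerDl powR_ge0.
- apply: continuous_in_subspaceT => x; rewrite inE/= in_itv/= => /andP[nx _].
  by apply: cvgM; [exact: cvg_cst|apply: cont; exact: lt_le_trans nx].
- split.
  + move=> x; rewrite in_itv/= => /andP[nx _].
    by apply: derivable_powR; rewrite in_itv/= andbT (lt_trans n0).
  + by apply: cvg_at_right_filter; exact: cont.
  + by apply: cvg_at_left_filter; exact: cont.
- move=> x; rewrite in_itv/= => /andP[nx _].
  by apply: powR_derive1; rewrite in_itv/= andbT (lt_trans n0).
Qed.

(** Raise y <= e^y, at y = x / (2p), to the power p. The rate 1/2 leaves an integrable e^(-x/2)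
    after multiplication by e^(-x). *)
Lemma powR_le_expR {R : realType} (p x : R) : 0 < p -> 0 <= x ->
  x `^ p <= (2 * p) `^ p * expR (x / 2).
Proof.
move=> p0 x0; have p20 : 0 < 2 * p by rewrite mulr_gt0.
have {1}-> : x = 2 * p * (x / (2 * p)) by field; rewrite lt0r_neq0.
have p2 := ltW p20; have xp : 0 <= x / (2 * p) by rewrite divr_ge0.
rewrite powRM// ler_wpM2l ?powR_ge0//.
have -> : x / 2 = x / (2 * p) * p by field; rewrite lt0r_neq0.
rewrite expRM ge0_ler_powR ?nnegrE ?expR_ge0 ?(ltW p0)//.
by apply: le_trans (expR_ge1Dx _); rewrite lerDr.
Qed.

(** Domination: x^(a-1) on ]0, 1], and beyond 1 the bound x^(a-1) <= x^a <= (2a)^a e^(x/2), which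
    leaves a multiple of the exponential density of rate 1/2. *)
Lemma egamma_lty {R : realType} (a : R) : 0 < a -> (egamma a < +oo)%E.
Proof.
move=> a0.
(* The last factor 2 cancels the normalization 1/2 of the exponential density. *)
pose K : R := (2 * a) `^ a * 2.
have K0 : 0 <= K by rewrite mulr_ge0 ?powR_ge0.
pose g1 (x : R) : R := a^-1 * ((fun x => a * x `^ (a - 1)) \_ `]0%R, 1%R]) x.
pose g2 (x : R) : R := K * exponential_pdf 2^-1 x.
have mr : measurable_fun setT ((fun x : R => a * x `^ (a - 1)) \_ `]0%R, 1%R]).
  apply/(measurable_restrictT _ _).1 => //; apply: measurable_funTS.
  by apply: measurable_funM => //; exact: measurable_powR.
have r0 x : 0 <= ((fun x : R => a * x `^ (a - 1)) \_ `]0%R, 1%R]) x.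
  by rewrite /patch; case: ifP => // _; rewrite mulr_ge0 ?powR_ge0// ltW.
have mg1 : measurable_fun setT g1 by exact: measurable_funM.
have mg2 : measurable_fun setT g2.
  by apply: measurable_funM => //; exact: measurable_exponential_pdf.
have e0 x : 0 <= exponential_pdf (2^-1 : R) x by exact: exponential_pdf_ge0.
have g10 x : 0 <= g1 x by rewrite mulr_ge0// invr_ge0 ltW.
have g20 x : 0 <= g2 x by rewrite mulr_ge0.
apply: (@le_lt_trans _ _ (\int[@lebesgue_measure R]_x ((g1 x)%:E + (g2 x)%:E))%E).
  apply: ge0_le_integral => //.
  - by move=> x _; rewrite lee_fin mulr_ge0 ?tpow_ge0 ?expR_ge0.
  - exact: measurable_egamma_integrand.
  - by apply: emeasurable_funD; exact/measurable_EFinP.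
  move=> x _; rewrite -EFinD lee_fin.
  have [x0|x0] := ltP 0 x; last first.
    by rewrite /tpow ltNge x0/= mul0r addr_ge0.
  rewrite /tpow x0; have [x1|x1] := leP x 1.
    apply: ler_wpDr => //.
    rewrite /g1 /patch mem_setE/= in_itv/= x0 x1/= mulrA mulVf ?gt_eqF// mul1r.
    by rewrite ler_piMr ?powR_ge0// expR_le1 oppr_le0 ltW.
  apply: ler_wpDl => //.
  rewrite /g2 exponential_pdfE; last exact: ltW.
  apply: (@le_trans _ _ (x `^ a * expR (- x))).
    by rewrite ler_wpM2r ?expR_ge0// ler_powR ?gerBl// ltW.
  apply: (@le_trans _ _ ((2 * a) `^ a * expR (x / 2) * expR (- x))).
    by rewrite ler_wpM2r ?expR_ge0// powR_le_expR// ltW.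
  rewrite le_eqVlt; apply/orP; left; apply/eqP.
  rewrite /K -!mulrA -expRD; congr (_ * _).
  by rewrite mulrA divff// mul1r; congr expR; field.
rewrite ge0_integralD//=; first last.
- exact/measurable_EFinP.
- by move=> x _; rewrite lee_fin.
- exact/measurable_EFinP.
- by move=> x _; rewrite lee_fin.
rewrite ge0_integralZl_real ?invr_ge0 ?(ltW a0)//; last exact/measurable_EFinP.
rewrite ge0_integralZl_real//; last first.
  by apply/measurable_EFinP; exact: measurable_exponential_pdf.
rewrite integral_exponential_pdf ?invr_gt0// mule1.
apply: lte_add_pinfty; last exact: ltry.
rewrite lte_mul_pinfty ?lee_fin ?invr_ge0 ?(ltW a0)//.
apply: le_lt_trans (ltry 1).
apply: le_trans (integral_powR_01_le1 a a0).
rewrite [leRHS]integral_mkcond le_eqVlt; apply/orP; left; apply/eqP.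
by apply: eq_integral => x _; rewrite /patch; case: ifP.
Qed.

(** On [1, 2] one has x^(a-1) >= x^(-1) >= 1/2 and e^(-x) >= e^(-2), so a positive constant bounds
    the integrand from below there. *)
Lemma egamma_gt0 {R : realType} (a : R) : 0 < a -> (0 < egamma a)%E.
Proof.
move=> a0.
pose g (x : R) : R := expR (- 2) / 2 * \1_(`[1, 2]%classic : set R) x.
apply: (@lt_le_trans _ _ (\int[@lebesgue_measure R]_x (g x)%:E)%E).
  rewrite ge0_integralZl_real; [| |by []|]; last 2 first.
  - by rewrite mulr_ge0 ?expR_ge0.
  - by apply/measurable_EFinP; exact: measurable_indic.
  rewrite integral_indic// setIT /= lebesgue_measure_itv/= lte_fin ltr1n/=.
  rewrite -EFinB -EFinM lte_fin !mulr_gt0 ?expR_gt0 ?subr_gt0 ?ltr1n//.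
apply: ge0_le_integral => //.
- by move=> x _; rewrite lee_fin !mulr_ge0 ?expR_ge0.
- apply/measurable_EFinP; apply: measurable_funM => //.
- exact: measurable_egamma_integrand.
move=> x _; rewrite lee_fin /g indicE mem_setE/= in_itv/=.
have [/andP[x1 x2]|_] := boolP (1 <= x <= 2); last first.
  by rewrite mulr0 mulr_ge0 ?tpow_ge0 ?expR_ge0.
have x0 : 0 < x by apply: lt_le_trans x1.
rewrite mulr1 mulrC /tpow x0 ler_pM ?expR_ge0 ?invr_ge0//; last first.
  by rewrite ler_expR lerN2.
apply: (@le_trans _ _ (x `^ (-1))).
  by rewrite powR_inv1 ?(ltW x0)// lef_pV2 ?posrE.
by apply: ler_powR => //; rewrite lerBrDr addrC subrr ltW.
Qed.

Lemma egamma_fin_num {R : realType} (a : R) : 0 < a -> egamma a \is a fin_num.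
Proof. by move=> a0; rewrite ge0_fin_numE ?egamma_ge0// egamma_lty. Qed.

Lemma Gamma_gt0 {R : realType} (a : R) : 0 < a -> 0 < Gamma a.
Proof. by move=> a0; rewrite GammaE fine_gt0// egamma_gt0// egamma_lty. Qed.

Lemma Gamma1 {R : realType} : Gamma (1 : R) = 1.
Proof.
(* The endpoint 0 is added because the exponential density of rate 1, whose total mass is 1, is
   supported on the closed half-line. *)
rewrite /Gamma /Rintegral integral_itv_obnd_cbnd; last first.
  apply/measurable_EFinP; apply: measurable_funTS; apply: measurable_funM => //.
  exact: measurableT_comp.
rewrite -[RHS]/(fine 1%E) -(@integral_exponential_pdf R 1)//; congr fine.
rewrite integral_mkcond; apply: eq_integral => x _.
rewrite /exponential_pdf /patch; case: ifP => // _.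
by rewrite subrr powRr0 !mul1r mulN1r.
Qed.

Lemma EFin_Gamma {R : realType} (a : R) : 0 < a -> (Gamma a)%:E = egamma a.
Proof. by move=> a0; rewrite GammaE fineK// egamma_fin_num. Qed.

Lemma ebeta1E {R : realType} (a b : R) : 0 < a -> 0 < b ->
  ebeta a b 1 = (Gamma a * Gamma b / Gamma (a + b))%:E.
Proof.
move=> a0 b0; have ab0 : 0 < a + b by exact: addr_gt0.
have : (Gamma a * Gamma b)%:E = ((Gamma (a + b))%:E * ebeta a b 1)%E.
  rewrite EFinM; transitivity (egamma a * egamma b)%E.
    by congr (_ * _)%E; exact: EFin_Gamma.
  by rewrite egammaM; congr (_ * _)%E; exact/esym/EFin_Gamma.
have := ebeta_ge0 a b 1; have := Gamma_gt0 (a + b) ab0.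
(* The value +oo is excluded: multiplied by Gamma(a + b) > 0 it would remain infinite, while the
   product of Gammas is finite. *)
case: (ebeta a b 1) => [r||] G0 // _.
  by move=> [->]; rewrite mulrAC divff ?mul1r// gt_eqF.
by rewrite gt0_muley ?lte_fin.
Qed.

(** * Riemann-Liouville integral of a power *)

Lemma integral_powR_convolution {R : realType} (a b t : R) : 0 < t ->
  (\int[@lebesgue_measure R]_(s in `[0%R, t])
     (s `^ (a - 1) * (t - s) `^ (b - 1))%:E = ebeta a b t)%E.
Proof.
(* The endpoints, a null set, are removed first: there [tpow] is 0, whereas a power of 0 with
   exponent 0 is 1. *)
move=> t0; rewrite integral_itv_bndoo; last first.
  apply/measurable_EFinP; apply: measurable_funTS; apply: measurable_funM => //.
  apply: (measurableT_comp (measurable_powR (b - 1))).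
  exact: measurable_funB.
rewrite integral_mkcond; apply: eq_integral => x _.
rewrite /patch mem_setE/= in_itv/= /tpow subr_gt0.
by case: (0 < x); case: (x < t); rewrite ?mul0r ?mulr0.
Qed.

Lemma Rintegral_powR_convolution {R : realType} (K q b t : R) :
  0 <= q -> 0 < b -> 0 <= t ->
  \int[lebesgue_measure]_(s in `[0, t]) (K * s `^ q * (t - s) `^ (b - 1)) =
  K * (Gamma (1 + q) * Gamma b / Gamma (1 + q + b)) * t `^ (q + b).
Proof.
move=> q0 b0; have q1 : 0 < 1 + q by rewrite ltr_wpDr.
rewrite le_eqVlt => /predU1P[<-|t0].
  (* At t = 0 the integral is over a point, and the right side vanishes because q + b > 0. *)
  by rewrite set_itv1 Rintegral_set1 powR0 ?mulr0// gt_eqF// ltr_wpDl.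
have E := integral_powR_convolution (1 + q) b t t0.
rewrite ebetaE ebeta1E// -EFinM (_ : 1 + q - 1 = q) in E; last by ring.
under eq_Rintegral => s _ do rewrite -mulrA.
(* Extracting K requires integrability; the integrand is nonnegative and [E] gives its integral a
   finite value. *)
rewrite RintegralZl//; last first.
  apply/integrableP; split.
    apply/measurable_EFinP; apply: measurable_funTS.
    apply: measurable_funM; first exact: measurable_powR.
    apply: (measurableT_comp (measurable_powR (b - 1))).
    exact: measurable_funB.
  under eq_integral => s _ do rewrite /= ger0_norm ?mulr_ge0 ?powR_ge0//.
  by rewrite E ltry.
rewrite /Rintegral E/= -[RHS]mulrA; congr (K * _); rewrite mulrC /tpow t0.
by congr (_ * _ `^ _); ring.
Qed.

(** * The cubic nonlinearity *)

Lemma eq_sum_triples {R : realType} (n : nat) (f g : nat -> nat -> nat -> R) :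
  (forall i j k, (i + j + k)%N = n -> f i j k = g i j k) ->
  sum_triples n f = sum_triples n g.
Proof.
move=> fg; rewrite /sum_triples; apply: eq_bigr => i _; apply: eq_bigr => j _.
by apply: eq_bigr => k /eqP /fg.
Qed.

Lemma sum_triplesD {R : realType} (n : nat) (f g : nat -> nat -> nat -> R) :
  sum_triples n (fun i j k => f i j k + g i j k) =
  sum_triples n f + sum_triples n g.
Proof.
rewrite /sum_triples -big_split; apply: eq_bigr => i _.
by rewrite -big_split; apply: eq_bigr => j _; rewrite -big_split.
Qed.

Lemma sum_triplesZ {R : realType} (n : nat) (a : R) (f : nat -> nat -> nat -> R) :
  sum_triples n (fun i j k => a * f i j k) = a * sum_triples n f.
Proof.
rewrite /sum_triples mulr_sumr; apply: eq_bigr => i _.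
by rewrite mulr_sumr; apply: eq_bigr => j _; rewrite mulr_sumr.
Qed.

Lemma sum_triples0 {R : realType} (f : nat -> nat -> nat -> R) :
  sum_triples 0 f = f 0%N 0%N 0%N.
Proof.
rewrite /sum_triples !big_ord_recl !big_ord0 big_mkcond big_ord_recl big_ord0 /=.
by rewrite !addr0.
Qed.

Lemma sum_triples1 {R : realType} (f : nat -> nat -> nat -> R) :
  sum_triples 1 f = f 0%N 0%N 1%N + f 0%N 1%N 0%N + f 1%N 0%N 0%N.
Proof.
rewrite /sum_triples; under eq_bigr => i _ do under eq_bigr => j _ do rewrite big_mkcond.
by rewrite !big_ord_recl !big_ord0 /= !big_ord_recl !big_ord0 /= !addr0 !add0r ?addrA.
Qed.

Lemma sum_triples2 {R : realType} (f : nat -> nat -> nat -> R) :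
  sum_triples 2 f = f 0%N 0%N 2 + f 0%N 1%N 1%N + f 0%N 2 0%N +
    (f 1%N 0%N 1%N + f 1%N 1%N 0%N) + f 2 0%N 0%N.
Proof.
rewrite /sum_triples; under eq_bigr => i _ do under eq_bigr => j _ do rewrite big_mkcond.
rewrite !big_ord_recl !big_ord0 /= !big_ord_recl !big_ord0 /= !addr0 !add0r.
by rewrite ?addrA.
Qed.

(** This four-parameter family is stable under differentiation, so a third derivative is obtained by
    applying the formula three times. *)
Lemma derive1_trig {R : realType} (k A B C D : R) :
  (fun y => A * cos (y * k) + B * sin (y * k) + C * cos y + D * sin y)^`()%classic =
  (fun y => B * k * cos (y * k) + - (A * k) * sin (y * k) + D * cos y + - C * sin y).
Proof.
apply/funext => y; rewrite derive1E.
have dk : is_derive y 1 (fun y : R => y * k) k.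
  by apply: is_derive_eq; rewrite scaler0 add0r /GRing.scale/= mulr1.
have dc : is_derive y 1 (fun y : R => cos (y * k)) (- sin (y * k) * k).
  exact: (@is_derive1_comp _ cos (fun y : R => y * k)).
have ds : is_derive y 1 (fun y : R => sin (y * k)) (cos (y * k) * k).
  exact: (@is_derive1_comp _ sin (fun y : R => y * k)).
apply: derive_val.
apply: is_derive_eq.
rewrite /GRing.scale/=; ring.
Qed.

Lemma cos_mul3 {R : realType} (z : R) : cos (z * 3) = 4 * cos z ^+ 3 - 3 * cos z.
Proof.
have s2 := sin2cos2 z.
have -> : z * 3 = z + z + z by ring.
rewrite !cosD sinD; ring: s2.
Qed.

Lemma sin_mul3 {R : realType} (z : R) : sin (z * 3) = 3 * sin z - 4 * sin z ^+ 3.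
Proof.
have s2 := cos2sin2 z.
have -> : z * 3 = z + z + z by ring.
rewrite !sinD cosD; ring: s2.
Qed.

(** The eight parity cases are the triple-angle formulas. The first harmonic has weight 3/4 for a
    pure cube and 1/4 for a mixed product, which [sigma] records; the third harmonic changes sign
    with each pair of sines. *)
Lemma psi3_linearize {R : realType} (i j k : nat) (z : R) :
  psi i z * psi j z * psi k z =
  3 / 4 * 3 ^- sigma i j k * psi (i + j + k) z +
  (-1) ^+ ((odd i + odd j + odd k)./2) / 4 * psi (i + j + k) (z * 3).
Proof.
have s2 := sin2cos2 z; have c2 := cos2sin2 z.
rewrite /psi /sigma !oddD.
case: (odd i); case: (odd j); case: (odd k) => /=;
  rewrite ?cos_mul3 ?sin_mul3 ?expr0 ?expr1; first [by field: s2 | by field: c2].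
Qed.

(** Includes the base x = 0, needed at time t = 0: if p + q = 0 then both exponents are 0. *)
Lemma powRD_ge0 {R : realType} (x p q : R) : 0 <= p -> 0 <= q ->
  x `^ (p + q) = x `^ p * x `^ q.
Proof.
move=> p0 q0; have [pq|pq] := eqVneq (p + q) 0; last by rewrite powRD// (negPf pq).
by have [-> ->] : p = 0 /\ q = 0 by [lra|]; rewrite addr0 powRr0 mulr1.
Qed.

(** Odd derivatives exchange sine and cosine, whence [psi n.+1]; the factor is 8/27 = 1/3 - 1/27,
    with a minus sign when [psi n] is a sine. *)
Lemma neg_derive1D3_psi {R : realType} (n : nat) (P Q x : R) :
  let f (y : R) := P * psi n (y / 3) + Q * psi n y in
  - f^`()%classic x - f^`(3)%classic x = (-1) ^+ n * (8 / 27) * P * psi n.+1 (x / 3).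
Proof.
rewrite /psi -(signr_odd R n) /=; case: (odd n) => /=.
- have -> : (fun y : R => P * sin (y / 3) + Q * sin y) =
    (fun y => 0 * cos (y / 3) + P * sin (y / 3) + 0 * cos y + Q * sin y).
    by apply/funext => y; ring.
  by rewrite !derive1_trig; field.
- have -> : (fun y : R => P * cos (y / 3) + Q * cos y) =
    (fun y => P * cos (y / 3) + 0 * sin (y / 3) + Q * cos y + 0 * sin y).
    by apply/funext => y; ring.
  by rewrite !derive1_trig; field.
Qed.

(** The constant 2/9 is the 3/4 of the linearization times the 8/27 of the differential operator. *)
Lemma hpm_source_monomial {R : realType} (beta : R) (a : nat -> R)
    (u : nat -> R -> R -> R) (n : nat) (x t : R) : 0 <= beta ->
  (forall m y, (m <= n)%N -> u m y t = a m * t `^ (beta * m%:R) * psi m (y / 3)) ->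
  hpm_source u n x t =
  (-1) ^+ n * (2 / 9) *
  sum_triples n (fun i j k => 3 ^- sigma i j k * (a i * a j * a k)) *
  t `^ (beta * n%:R) * psi n.+1 (x / 3).
Proof.
move=> b0 ua; rewrite /hpm_source.
pose T := t `^ (beta * n%:R).
(* [Q] gathers the third harmonics, which the operator annihilates; [S] is the sum surviving in the
   first harmonic. *)
pose Q := sum_triples n (fun i j k =>
  T * a i * a j * a k * ((-1) ^+ ((odd i + odd j + odd k)./2) / 4)).
pose S := sum_triples n (fun i j k => 3 ^- sigma i j k * (a i * a j * a k)).
have -> : (fun y => hpm_cubic u n y t) =
    (fun y : R => (T * (3 / 4) * S) * psi n (y / 3) + Q * psi n y).
  apply/funext => y; rewrite /hpm_cubic /Q /S -sum_triplesZ.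
  rewrite ![_ * psi n _]mulrC -!sum_triplesZ -sum_triplesD.
  apply: eq_sum_triples => i j k ijk.
  have -> : T = t `^ (beta * i%:R) * t `^ (beta * j%:R) * t `^ (beta * k%:R).
    rewrite /T -ijk !natrD !mulrDr.
    by rewrite !powRD_ge0 ?addr_ge0 ?mulr_ge0 ?ler0n.
  have H := psi3_linearize i j k (y / 3).
  rewrite ijk divfK// in H.
  rewrite !ua -?ijk; [|lia..].
  rewrite ijk.
  transitivity (t `^ (beta * i%:R) * t `^ (beta * j%:R) * t `^ (beta * k%:R) *
     (a i * a j * a k) * (psi i (y / 3) * psi j (y / 3) * psi k (y / 3))).
    by ring.
  by rewrite H; ring.
by rewrite neg_derive1D3_psi -/S -/T; field.
Qed.

(** * The Volterra equation with a monomial source *)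

(** The prefactor 1 / Gamma(beta) cancels the Gamma(beta) in Euler's value of the Beta integral. *)
Lemma caputo_solution_monomial {R : realType} (beta K q : R) (F v : R -> R) (t : R) :
  0 < beta -> 0 <= q -> 0 <= t -> (forall s, 0 <= s -> F s = K * s `^ q) ->
  caputo_solution beta F 0 v ->
  v t = K * Gamma (1 + q) / Gamma (1 + q + beta) * t `^ (q + beta).
Proof.
move=> b0 q0 t0 FK /(_ t t0) ->; rewrite add0r.
under eq_Rintegral => s.
  rewrite inE/= in_itv/= => /andP[s0 _]; rewrite (FK s s0); over.
rewrite Rintegral_powR_convolution//.
have Gb : Gamma beta != 0 by rewrite gt_eqF// Gamma_gt0.
have Gq : Gamma (1 + q + beta) != 0 by rewrite gt_eqF// Gamma_gt0; lra.
move: (Gamma beta) (Gamma (1 + q)) (Gamma (1 + q + beta)) Gb Gq => gb g1 gq Gb Gq.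
by field; rewrite Gq.
Qed.

(** * Splitting a series by parity *)

Lemma cvg_uphalf : uphalf @ \oo --> \oo.
Proof.
move=> /= A [N _ NA]; exists N.*2 => // n /= Nn; apply: NA => /=; lia.
Qed.

Lemma cvg_half : half @ \oo --> \oo.
Proof.
move=> /= A [N _ NA]; exists N.*2 => // n /= Nn; apply: NA => /=; lia.
Qed.

(** Among the indices below n, the even ones number n/2 rounded up and the odd ones n/2 rounded
    down. *)
Lemma series_even_odd {R : realType} (v a b : nat -> R) (p q : R) (n : nat) :
  (forall k, v k.*2 = a k * p) -> (forall k, v k.*2.+1 = b k * q) ->
  series v n = series a (uphalf n) * p + series b n./2 * q.
Proof.
move=> va vb; elim: n => [|n IHn]; first by rewrite /series /= !big_geq// !mul0r addr0.
rewrite /series /= big_nat_recr//= -[X in X + _]/(series v n) IHn uphalf_half.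
case: (boolP (odd n)) => no /=.
  have nE : n = n./2.*2.+1 by rewrite -{1}(odd_double_half n) no.
  rewrite {3}nE vb add1n /series /= [X in _ = _ + X * _]big_nat_recr//=; ring.
have nE : n = n./2.*2 by rewrite -{1}(odd_double_half n) (negPf no).
rewrite {3}nE va add0n /series /= [X in _ = X * _ + _]big_nat_recr//=; ring.
Qed.

Lemma powR3E {R : realType} (n : nat) :
  3 `^ (- (n%:R - 2^-1)) = (3 : R) `^ 2^-1 / 3 ^+ n.
Proof.
rewrite opprB powRD; last by rewrite pnatr_eq0 implybT.
by rewrite powRN powR_mulrn.
Qed.

Lemma sqr_powR_half {R : realType} (a : R) : 0 <= a -> (a `^ 2^-1) ^+ 2 = a.
Proof. by move=> a0; rewrite powR12_sqrt// sqr_sqrtr. Qed.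

(** * Monomial form of the terms *)

(** Strong induction: the source of order n involves only terms of order at most n, so it is a
    multiple of t^(beta n), and its fractional integral has exponent beta (n + 1). Sampling [u]
    defines all coefficients at once; their recursion then follows from uniqueness of the
    coefficient. *)
Lemma hpm_terms_monomial {R : realType} (beta : R) (u : nat -> R -> R -> R) :
  0 < beta ->
  (forall x t : R, 0 <= t -> u 0%N x t = (3 / 2) `^ (2^-1) * cos (x / 3)) ->
  (forall (n : nat) (x : R),
     caputo_solution beta (hpm_source u n x) 0 (u n.+1 x)) ->
  exists a : nat -> R,
    [/\ a 0%N = (3 / 2) `^ (2^-1),
        forall (n : nat) (x t : R), 0 <= t ->
          u n x t = a n * t `^ (beta * n%:R) * psi n (x / 3)
      & forall n : nat, a n.+1 = (-1) ^+ n * (2 / 9) *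
          sum_triples n (fun i j k => 3 ^- sigma i j k * (a i * a j * a k)) *
          Gamma (1 + beta * n%:R) / Gamma (1 + beta * n.+1%:R)].
Proof.
move=> b0 hu0 hu.
(* [psi n (xn n / 3) = 1], so the coefficient is read off at [t = 1]. *)
pose xn (n : nat) : R := if odd n then pi / 2 * 3 else 0.
have psixn n : psi n (xn n / 3) = 1.
  rewrite /psi /xn; case: ifP => _; first by rewrite mulfK// sin_pihalf.
  by rewrite mul0r cos0.
pose a n := u n (xn n) 1.
have aE n K : (forall x t, 0 <= t -> u n x t = K * t `^ (beta * n%:R) * psi n (x / 3)) ->
    a n = K.
  by move=> /(_ (xn n) 1 ler01); rewrite psixn powR1 !mulr1.
have step n : (forall m, (m <= n)%N -> forall x t, 0 <= t ->
      u m x t = a m * t `^ (beta * m%:R) * psi m (x / 3)) ->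
    forall x t, 0 <= t -> u n.+1 x t = ((-1) ^+ n * (2 / 9) *
          sum_triples n (fun i j k => 3 ^- sigma i j k * (a i * a j * a k)) *
          Gamma (1 + beta * n%:R) / Gamma (1 + beta * n.+1%:R)) *
      t `^ (beta * n.+1%:R) * psi n.+1 (x / 3).
  move=> IH x t t0.
  have bn : 0 <= beta * n%:R by rewrite mulr_ge0// ltW.
  (* For fixed x the spatial factor is constant in time and is absorbed into [K]. *)
  pose K := (-1) ^+ n * (2 / 9) *
    sum_triples n (fun i j k => 3 ^- sigma i j k * (a i * a j * a k)) *
    psi n.+1 (x / 3).
  rewrite (caputo_solution_monomial beta K (beta * n%:R) (hpm_source u n x)
    (u n.+1 x) t)//; last first.
    move=> s s0; rewrite (hpm_source_monomial beta a) ?ltW//; first by rewrite /K; ring.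
    by move=> m y mn; exact: IH.
  have -> : beta * n.+1%:R = beta * n%:R + beta by rewrite -natr1; ring.
  by rewrite /K addrA; ring.
have ua n : forall x t, 0 <= t -> u n x t = a n * t `^ (beta * n%:R) * psi n (x / 3).
  elim/ltn_ind: n => -[_|n IH].
    have E x t : 0 <= t ->
        u 0%N x t = (3 / 2) `^ (2^-1) * t `^ (beta * 0%:R) * psi 0 (x / 3).
      by move=> t0; rewrite hu0// mulr0 powRr0 mulr1.
    by rewrite (aE 0%N _ E).
  have E := step n IH; by rewrite (aE _ _ E).
exists a; split => //.
  by apply: aE => x t t0; rewrite hu0// mulr0 powRr0 mulr1.
by move=> n; apply: aE; apply: step => m _; exact: ua.
Qed.

(** * Normalized coefficients and summation *)

Theorem proposition5p1 (R : realType) (beta : R)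
  (hbeta : 0 < beta <= 1)
  (u : nat -> R -> R -> R)
  (hu0 : forall x t : R, 0 <= t ->
     u 0%N x t = (3 / 2) `^ (2^-1) * cos (x / 3))
  (hu : forall (n : nat) (x : R),
     caputo_solution beta (hpm_source u n x) 0 (u n.+1 x)) :
  exists c : nat -> R,
    [/\ [/\ c 0%N = 1, c 1%N = 1, c 2%N = 1 &
          c 3%N = (3 * Gamma (1 + beta) ^+ 2 - Gamma (1 + 2 * beta))
                  / Gamma (1 + beta) ^+ 2],
        forall (n : nat) (x t : R), 0 <= t ->
          u n x t =
            (-1) ^+ n./2
            * (c n * 2 `^ (- 2^-1) * 3 `^ (- (n%:R - 2^-1)) * t `^ (beta * n%:R)
               / Gamma (1 + beta * n%:R))
            * psi n (x / 3),
        forall n : nat,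
          c n.+1 =
            (-1) ^+ n./2
            * sum_triples n (fun n1 n2 n3 =>
                (-1) ^+ (n1./2 + n2./2 + n3./2) * 3 ^- sigma n1 n2 n3
                * Gamma (1 + beta * n%:R) * c n1 * c n2 * c n3
                / (Gamma (1 + beta * n1%:R) * Gamma (1 + beta * n2%:R)
                   * Gamma (1 + beta * n3%:R)))
      & let A (t : R) (k : nat) : R :=
          (-1) ^+ k
          * (c (2 * k)%N * 2 `^ (- 2^-1) * 3 `^ (- (2 * k%:R - 2^-1))
             * t `^ (2 * beta * k%:R) / Gamma (1 + 2 * beta * k%:R)) in
        let B (t : R) (k : nat) : R :=
          (-1) ^+ k
          * (c (2 * k + 1)%N * 2 `^ (- 2^-1) * 3 `^ (- (2 * k%:R + 2^-1))
             * t `^ (beta * (2 * k%:R + 1)) / Gamma (1 + beta * (2 * k%:R + 1))) in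
        forall x t : R, 0 <= t ->
          cvgn (series (A t)) -> cvgn (series (B t)) ->
          series (fun n => u n x t) @ \oo -->
            limn (series (A t)) * cos (x / 3) + limn (series (B t)) * sin (x / 3)].
Proof.
have /andP[b0 _] := hbeta.
have [a [a0 ua aS]] := hpm_terms_monomial beta u b0 hu0 hu.
pose r2 : R := 2 `^ (- 2^-1); pose r3 : R := 3 `^ 2^-1.
pose G (n : nat) := Gamma (1 + beta * n%:R).
have G0 n : G n != 0.
  by rewrite gt_eqF// Gamma_gt0// ltr_wpDr// mulr_ge0// ltW.
have r2sq : r2 ^+ 2 = 2^-1 by rewrite /r2 powRN exprVn sqr_powR_half.
have r3sq : r3 ^+ 2 = 3 by rewrite /r3 sqr_powR_half.
have r20 : r2 != 0 by rewrite gt_eqF// powR_gt0.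
have r30 : r3 != 0 by rewrite gt_eqF// powR_gt0.
have e30 n : (3 : R) ^+ n != 0 by rewrite expf_neq0.
have sgn2 m : (-1) ^+ m * (-1) ^+ m = 1 :> R by rewrite -exprMn mulrNN mulr1 expr1n.
(* The claimed formula for u_n solved for c_n, with 3^(-(n - 1/2)) = [r3] / 3^n and the sign being
   its own inverse. *)
pose c n := (-1) ^+ n./2 * a n * G n * 3 ^+ n / (r2 * r3).
have aE n : a n = (-1) ^+ n./2 * (c n * r2 * (r3 / 3 ^+ n) / G n).
  rewrite /c; transitivity ((-1) ^+ n./2 * (-1) ^+ n./2 * a n).
    by rewrite sgn2 mul1r.
  move: (G0 n) (e30 n); move: (G n) (3 ^+ n) ((-1) ^+ n./2) => g e s g0 ee0.
  by clear -r20 r30 g0 ee0; clearbody r2 r3; field; rewrite r30 r20 g0 ee0.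
have cS n : c n.+1 = (-1) ^+ n./2
    * sum_triples n (fun n1 n2 n3 =>
        (-1) ^+ (n1./2 + n2./2 + n3./2) * 3 ^- sigma n1 n2 n3
        * G n * c n1 * c n2 * c n3 / (G n1 * G n2 * G n3)).
  (* Each of the three coefficients carries a factor [r2 * r3], and ([r2 * r3])^2 = 3/2; this is the
     source of the 2/3. *)
  have -> : sum_triples n (fun n1 n2 n3 =>
        (-1) ^+ (n1./2 + n2./2 + n3./2) * 3 ^- sigma n1 n2 n3
        * G n * c n1 * c n2 * c n3 / (G n1 * G n2 * G n3)) =
      (G n * (2 / 3) * 3 ^+ n / (r2 * r3)) *
      sum_triples n (fun i j k => 3 ^- sigma i j k * (a i * a j * a k)).
    rewrite -sum_triplesZ; apply: eq_sum_triples => i j k ijk.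
    rewrite !aE -ijk !exprD.
    move: (G0 i) (G0 j) (G0 k) (e30 i) (e30 j) (e30 k) (c i) (c j) (c k).
    move: ((-1) ^+ i./2) ((-1) ^+ j./2) ((-1) ^+ k./2) (3 ^- sigma i j k).
    move: (G i) (G j) (G k) (G (i + j + k)%N) (3 ^+ i) (3 ^+ j) (3 ^+ k).
    move=> gi gj gk g ei ej ek si sj sk sg gi0 gj0 gk0 ei0 ej0 ek0 ci cj ck.
    clear -r20 r30 r2sq r3sq gi0 gj0 gk0 ei0 ej0 ek0; clearbody r2 r3.
    transitivity (g * (2 / 3) * (si * sj * sk * sg * (ci * cj * ck) /
      (gi * gj * gk)) * (r2 ^+ 2 * r3 ^+ 2)).
      by rewrite r2sq r3sq; field; rewrite ?gi0 ?gj0 ?gk0.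
    by field; rewrite ?r20 ?r30 ?gi0 ?gj0 ?gk0 ?ei0 ?ej0 ?ek0.
  rewrite /c aS.
  rewrite -[Gamma (1 + beta * n%:R)]/(G n) -[Gamma (1 + beta * n.+1%:R)]/(G n.+1).
  (* Passing from n to n + 1 changes the sign prefactor by (-1)^n, which cancels the (-1)^n in the
     recursion for [a]; the powers of 3 combine as 3 * 2/9 = 2/3. *)
  rewrite (_ : n.+1./2 = n./2 + odd n)%N; last by lia.
  rewrite exprD exprS -(signr_odd R n).
  transitivity ((-1) ^+ odd n * (-1) ^+ odd n * ((-1) ^+ n./2 *
    (G n * (2 / 3) * 3 ^+ n / (r2 * r3) *
     sum_triples n (fun i j k => 3 ^- sigma i j k * (a i * a j * a k))))); last first.
    by rewrite sgn2 mul1r.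
  move: (G0 n.+1); move: (G n.+1) (G n) (3 ^+ n) ((-1) ^+ n./2) ((-1) ^+ odd n).
  move: (sum_triples _ _) => S g1 g e s s' g10.
  by clear -r20 r30 g10; clearbody r2 r3; field; rewrite ?r20 ?r30 ?g10.
have psiE n x t : 0 <= t -> u n x t = (-1) ^+ n./2
    * (c n * r2 * 3 `^ (- (n%:R - 2^-1)) * t `^ (beta * n%:R) / G n) * psi n (x / 3).
  by move=> t0; rewrite powR3E -/r3 ua// {1}aE; ring.
have Gz : G 0%N = 1 by rewrite /G mulr0 addr0 Gamma1.
have a0E : a 0%N = r2 * r3.
  by rewrite a0 powRM ?invr_ge0// mulrC /r2 -mulN1r powRrM powR_inv1.
have c0 : c 0%N = 1.
  by rewrite /c a0E Gz !expr0 !mul1r !mulr1 divff// mulf_neq0.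
have G1E : G 1%N = Gamma (1 + beta) by rewrite /G mulr1.
have G2E : G 2 = Gamma (1 + 2 * beta) by rewrite /G mulrC.
exists c; split; [|exact: psiE|exact: cS|].
  rewrite -G1E -G2E; move: (G0 1%N) (G0 2).
  clear - Gz cS c0; clearbody c G => G10 G20.
  have c1 : c 1%N = 1.
    by rewrite cS sum_triples0 c0 Gz /sigma/= !expr0; field.
  have c2 : c 2 = 1.
    (* Three mixed triples, each of weight 1/3. *)
    by rewrite cS sum_triples1 c0 c1 Gz /sigma/= !expr0 expr1; field.
  split => //.
  (* The three arrangements of (0, 0, 2) contribute 3, those of (0, 1, 1), of weight 1/3 each,
     contribute -Gamma(1 + 2 beta) / Gamma(1 + beta)^2. *)
  by rewrite cS sum_triples2 c0 c1 c2 Gz /sigma/= !expr0 !expr1; field; rewrite G10 G20.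
move=> A B x t t0 cA cB.
(* An exact identity between partial sums, so the series of the u_n converges as soon as both parity
   series do. *)
have E : series (fun n => u n x t) = (fun n =>
    series (A t) (uphalf n) * cos (x / 3) + series (B t) n./2 * sin (x / 3)).
  apply/funext => n; apply: series_even_odd => k.
    rewrite psiE// /A /psi odd_double doubleK -mul2n natrM -/r2.
    by rewrite /G natrM (_ : beta * (2 * k%:R) = 2 * beta * k%:R)//; ring.
  rewrite (_ : k.*2.+1 = 2 * k + 1)%N; last by lia.
  rewrite psiE// /B /psi (_ : odd (2 * k + 1)); last by lia.
  rewrite (_ : (2 * k + 1)./2 = k); last by lia.
  rewrite /G natrD natrM -/r2.
  by rewrite (_ : 2 * k%:R + 1 - 2^-1 = 2 * k%:R + 2^-1 :> R)//; lra.
have cA' : series (A t) (uphalf n) @[n --> \oo] --> limn (series (A t)).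
  exact: (cvg_comp _ _ cvg_uphalf cA).
have cB' : series (B t) n./2 @[n --> \oo] --> limn (series (B t)).
  exact: (cvg_comp _ _ cvg_half cB).
by rewrite E; apply: cvgD; [exact: cvgM cA' (cvg_cst _)|exact: cvgM cB' (cvg_cst _)].
Qed.
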